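(* Consider the preconditioned stochastic gradient iteration $u^k=u^{k-1}+\mu_k(B+\gamma C)^{-1}(b^k-A_ku^{k-1})$, $k\ge 1$, under the assumptions listed in the context, with error $e^k=u^k-\hat u$. There exist $\gamma_0>0$ and $\mu_0>0$ such that, if the sequence $(\mu_k)_{k\ge1}$ satisfies $0<\mu_k\le\mu_0$ for all $k$ and $\sum_{k=1}^\infty\mu_k=\infty$, then $$\lim_{k\to+\infty}E(e^k)=0\quad\text{for all } 0\le\gamma\le\gamma_0 .$$
   Context: Setting. $X=X(t)$ is a stationary stochastic process with values in an interval of $\mathbb R$, each $X(t)$ having density $\rho$; $E(g(X))=\int g\rho\,dx$. $f$ is a deterministic function and $\phi_1,\dots,\phi_M$ are linearly independent basis functions on the sample space. Put $A=[a_{ij}]\in\mathbb R^{M\times M}$, $a_{ij}=E(\phi_i(X)\phi_j(X))$, and $b=[b_i]\in\mathbb R^M$, $b_i=E(\phi_i(X)f(X))$. These are finite and $A$ is symmetric positive definite. The theoretical best approximation $\hat u=\arg\min_{u\in\mathbb R^M}E\big((\sum_ju_j\phi_j(X)-f(X))^2\big)$ is the unique solution of $A\hat u=b$. Samples. For $k=1,2,\dots$, $N$ samples of $X$ are taken at times $t^k_1,\dots,t^k_N\in[t_1^k,t_N^k]$ with $t^k_N<t^{k+1}_1$, and $A_k=[a^k_{ij}]$, $a^k_{ij}=\frac1N\sum_{n=1}^N\phi_i(X(t^k_n))\phi_j(X(t^k_n))$, $b^k=[b^k_i]$, $b^k_i=\frac1N\sum_{n=1}^N\phi_i(X(t^k_n))f(X(t^k_n))$,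 so that $E(A_k)=A$, $E(b^k)=b$. Put $\theta^k=b^k-b$ and $\Omega_k=A_k-A$. Preconditioner. $B,C$ are fixed real $M\times M$ matrices (independent of $k$), $B$ symmetric positive definite, $C$ symmetric positive semidefinite, and $x^TB^{-1}Ax>0$ for all $x\in\mathbb R^M$ with $\|x\|=1$. For $\gamma\ge0$, $\Psi=(B+\gamma C)^{-1}$. Iteration. $u^0$ is a (possibly random) vector in $\mathbb R^M$ with finite second moments, not depending on $\gamma$ or on the step sizes; $\mu_k>0$ are deterministic step sizes; $u^k=u^{k-1}+\mu_k\Psi(b^k-A_ku^{k-1})$ for $k\ge1$; $e^k=u^k-\hat u$ for $k\ge 0$. Assumptions on the random variables: 1. the $\theta^k$ are i.i.d. with $E(\theta^k)=0$; 2. the $\Omega_k$ are symmetric and i.i.d. with $E(\Omega_k)=0$; 3. the covariances $E(\theta^k\theta^{kT})$, $E(\mathrm{vec}(\Omega_k)\mathrm{vec}(\Omega_k)^T)$, $E(\mathrm{vec}(\Omega_k)\theta^{kT})$ exist (finite second moments) and do not depend on $k$, where $\mathrm{vec}$ stacks the columns of a matrix into one column vector; 4. for every $k\ge1$ (and for the iterates generated with any $\gamma\ge 0$ and any positive step sizes), $u^{k-1}$ and its products are pairwise independent of $\theta^k$ and $\Omega_k$ and their products: every entry of $u^{k-1}$ and every product of two entries of $u^{k-1}$ is independent of every entry of $\theta^k$ or $\Omega_k$ and of every product of two such entries. The constants in the claim may depend on the data $A,B,C$ but not on $\gamma$, $k$ or the sequence $(\mu_k)$. *)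

(* Defs.v *)
From HB Require Import structures.
From mathcomp Require Import all_boot all_order all_algebra.
From mathcomp Require Import all_classical all_reals all_analysis.

Set Implicit Arguments.
Unset Strict Implicit.
Unset Printing Implicit Defensive.

Import Order.TTheory GRing.Theory Num.Theory.
Import numFieldNormedType.Exports.

Local Open Scope classical_set_scope.
Local Open Scope ring_scope.

Section linear_algebra.
Context {R : realType} {M : nat}.
Implicit Types (x : 'cV[R]_M) (W : 'M[R]_M).

Definition qform W x : R := (x^T *m W *m x) 0 0.

Definition spd W : Prop := W^T = W /\ forall x, x != 0 -> 0 < qform W x.

Definition spsd W : Prop := W^T = W /\ forall x, 0 <= qform W x.

(* The norm `|x| of the library is the sup norm on matrices. *)
Definition euclidean_norm x : R := Num.sqrt (\sum_i x i 0 ^+ 2).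

(* [mxvec] lists the entries row by row, hence the inner transpose. *)
Definition vec W : 'cV[R]_(M * M) := (mxvec W^T)^T.

End linear_algebra.

Section random_matrices.
Context {d : measure_display} {T : measurableType d} {R : realType}.
Variable P : probability T R.

Section one_size.
Context {m n : nat}.
Implicit Types Y : T -> 'M[R]_(m, n).

Definition random_mx Y : Prop :=
  forall i j, measurable_fun [set: T] (fun w => Y w i j).

Definition integrable_mx Y : Prop :=
  forall i j, P.-integrable [set: T] (fun w => (Y w i j)%:E).

(* Meaningful for [integrable_mx] matrices only: [fine] sends infinite values
   to 0. *)
Definition Emx Y : 'M[R]_(m, n) :=
  \matrix_(i, j) fine ('E_P[fun w => Y w i j])%E.

Definition has_mean Y (m0 : 'M[R]_(m, n)) : Prop :=
  integrable_mx Y /\ Emx Y = m0.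

Definition borel_mx : set (set 'M[R]_(m, n)) :=
  <<s [set B : set 'M[R]_(m, n) | open B] >>.

Definition mutually_independent (Y : nat -> T -> 'M[R]_(m, n)) : Prop :=
  forall (ks : seq nat) (S : nat -> set 'M[R]_(m, n)),
    uniq ks -> (forall k, borel_mx (S k)) ->
    P [set w | forall k, k \in ks -> S k (Y k w)] =
    (\prod_(k <- ks) P (Y k @^-1` S k))%E.

Definition identically_distributed (Y : nat -> T -> 'M[R]_(m, n)) : Prop :=
  forall (k l : nat) (S : set 'M[R]_(m, n)), borel_mx S ->
    P (Y k @^-1` S) = P (Y l @^-1` S).

Definition iid (Y : nat -> T -> 'M[R]_(m, n)) : Prop :=
  mutually_independent Y /\ identically_distributed Y.

Definition entries Y : set (T -> R) :=
  [set Z | exists i j, Z = (fun w => Y w i j)].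

End one_size.

Definition with_products (F : set (T -> R)) : set (T -> R) :=
  F `|` [set Z | exists Z1 Z2, [/\ F Z1, F Z2 & Z = (fun w => Z1 w * Z2 w)]].

Definition independent (Z1 Z2 : T -> R) : Prop :=
  forall S1 S2 : set R, measurable S1 -> measurable S2 ->
    P (Z1 @^-1` S1 `&` Z2 @^-1` S2) =
    (P (Z1 @^-1` S1) * P (Z2 @^-1` S2))%E.

(* The second moment E(Y_k Z_k^T) exists for every k >= 1 and is the same for
   all of them. *)
Definition stationary_moment {p q : nat}
    (Y : nat -> T -> 'cV[R]_p) (Z : nat -> T -> 'cV[R]_q) : Prop :=
  (forall k, (1 <= k)%N -> integrable_mx (fun w => Y k w *m (Z k w)^T)) /\
  (forall k l, (1 <= k)%N -> (1 <= l)%N ->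
    Emx (fun w => Y k w *m (Z k w)^T) = Emx (fun w => Y l w *m (Z l w)^T)).

(* Rectangles generate the Borel sets of R^n, so this is shift invariance of
   all the finite-dimensional laws; [Tm] is the time domain. *)
Definition strictly_stationary (Tm : interval R)
    (X : R -> {RV P >-> R}) : Prop :=
  forall (n : nat) (s : 'I_n -> R) (h : R) (S : 'I_n -> set R),
    (forall i, s i \in Tm) -> (forall i, s i + h \in Tm) ->
    (forall i, measurable (S i)) ->
    P [set w | forall i, S i (X (s i) w)] =
    P [set w | forall i, S i (X (s i + h) w)].

Definition has_density (I : interval R) (rho : R -> R)
    (X : {RV P >-> R}) : Prop :=
  forall S : set R, measurable S ->
    P (X @^-1` S) =
    (\int[lebesgue_measure]_(x in S `&` [set` I]) (rho x)%:E)%E.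

End random_matrices.

Section least_squares.
Context {R : realType} {M : nat}.
Variables (I : interval R) (rho : R -> R).
Variables (phi : 'I_M -> R -> R) (f : R -> R).

Definition Erho (g : R -> R) : \bar R :=
  (\int[lebesgue_measure]_(x in [set` I]) (g x * rho x)%:E)%E.

Definition Erho_finite (g : R -> R) : Prop :=
  lebesgue_measure.-integrable [set` I] (fun x => (g x * rho x)%:E).

Definition lin_indep : Prop :=
  forall c : 'I_M -> R,
    (forall x, x \in I -> \sum_i c i * phi i x = 0) -> forall i, c i = 0.

Definition gram : 'M[R]_M :=
  \matrix_(i, j) fine (Erho (fun x => phi i x * phi j x)).

Definition load : 'cV[R]_M := \col_i fine (Erho (fun x => phi i x * f x)).

Definition mean_sq_error (v : 'cV[R]_M) : \bar R :=
  Erho (fun x => (\sum_j v j 0 * phi j x - f x) ^+ 2).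

Definition argmin_mse : set 'cV[R]_M :=
  [set v | forall v', (mean_sq_error v <= mean_sq_error v')%E].

End least_squares.

Section sampling.
Context {d : measure_display} {T : measurableType d} {R : realType}.
Context {P : probability T R} {M : nat}.
Variables (X : R -> {RV P >-> R}) (phi : 'I_M -> R -> R) (f : R -> R).
Variables (N : nat) (t : nat -> nat -> R).

(* [t k n] is the n-th sampling time of the k-th batch; both indices start
   at 1, and the values at index 0 are never used. *)
Definition sampling_times (Tm : interval R) : Prop :=
  (forall k n, (1 <= k)%N -> (1 <= n <= N)%N ->
    t k n \in Tm /\ t k 1%N <= t k n <= t k N) /\
  (forall k, (1 <= k)%N -> t k N < t k.+1 1%N).

Definition sample_mean (g : R -> R) (k : nat) (w : T) : R :=
  N%:R^-1 * \sum_(1 <= n < N.+1) g (X (t k n) w).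

Definition sample_gram (k : nat) (w : T) : 'M[R]_M :=
  \matrix_(i, j) sample_mean (fun x => phi i x * phi j x) k w.

Definition sample_load (k : nat) (w : T) : 'cV[R]_M :=
  \col_i sample_mean (fun x => phi i x * f x) k w.

Definition precond (B C : 'M[R]_M) (gamma : R) : 'M[R]_M :=
  invmx (B + gamma *: C).

Fixpoint iterate (B C : 'M[R]_M) (u0 : T -> 'cV[R]_M) (gamma : R)
    (mu : nat -> R) (k : nat) (w : T) : 'cV[R]_M :=
  if k is k'.+1 then
    let v := iterate B C u0 gamma mu k' w in
    v + mu k *: (precond B C gamma *m (sample_load k w - sample_gram k w *m v))
  else u0 w.

End sampling.

(* Main.v *)
(* Since b = A uhat by the normal equations, and since Omega_k and u^(k-1) are
   independent with E(Omega_k) = 0, the mean errors satisfy the deterministic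
   recursion m_k = m_(k-1) - mu_k W^-1 A m_(k-1) with W = B + gamma C. In the
   energy V = m^T A m and with p = W^-1 A m, one step gives
     V_k = V_(k-1) - 2 mu_k p^T W p + mu_k^2 p^T A p.
   If A <= K B as quadratic forms, then A <= K W for all gamma >= 0 because C is
   semidefinite, so the step mu_k <= 1/K, a bound free of gamma, yields
   V_k <= V_(k-1) - mu_k p^T W p <= (1 - c mu_k) V_(k-1), where c > 0 may depend
   on gamma. Hence V_k (1 + c (mu_1 + ... + mu_k)) <= V_0, and V_k tends to 0. *)

Require Import Defs.
From HB Require Import structures.
From mathcomp Require Import all_boot all_order all_algebra.
From mathcomp Require Import all_classical all_reals all_analysis measurable_realfun.
From mathcomp Require Import ring lra.

Import Order.TTheory GRing.Theory Num.Theory.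
Import numFieldNormedType.Exports.

Local Open Scope classical_set_scope.
Local Open Scope ring_scope.

(** * Quadratic forms: coordinate bounds, domination and decay of the energy *)

Section quadratic_forms.
Context {R : realType} {M : nat}.
Implicit Types (x y v : 'cV[R]_M) (S W A B C : 'M[R]_M).

Definition bform W x y : R := (x^T *m W *m y) 0 0.

Lemma bformC W x y : W^T = W -> bform W x y = bform W y x.
Proof.
move=> Ws; rewrite /bform -[in LHS](trmxK (_ *m y)) mxE !trmx_mul trmxK Ws.
by rewrite mulmxA.
Qed.

Lemma qformDZ W x y (s : R) : W^T = W ->
  qform W (x + s *: y) = qform W x + 2 * s * bform W y x + s ^+ 2 * qform W y.
Proof.
move=> Ws; have := bformC W x y Ws; rewrite /bform /qform => h.
have -> : (x + s *: y)^T = x^T + s *: y^T by rewrite linearD linearZ.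
rewrite !mulmxDl !mulmxDr -!scalemxAl -!scalemxAr.
pose e (X : 'M[R]_1) := X 0 0; rewrite -!/(e _) in h *.
have eD X Y : e (X + Y) = e X + e Y by rewrite /e mxE.
have eZ r X : e (r *: X) = r * e X by rewrite /e mxE.
by rewrite !(eD, eZ) h; ring.
Qed.

Lemma spd_ge0 W x : spd W -> 0 <= qform W x.
Proof.
move=> [_ W0]; have [->|x0] := eqVneq x 0; last exact/ltW/W0.
by rewrite /qform mulmx0 mxE.
Qed.

Lemma spd_unitmx W : spd W -> W \in unitmx.
Proof.
move=> [Ws W0]; rewrite -row_free_unit -kermx_eq0.
apply/rowV0P => v /sub_kermxP vW.
apply: contraTeq isT => v0.
have : 0 < qform W v^T by apply: W0; rewrite trmx_eq0.
by rewrite /qform trmxK vW mul0mx mxE ltxx.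
Qed.

Lemma qformD_mx W C (g : R) x : qform (W + g *: C) x = qform W x + g * qform C x.
Proof.
by rewrite /qform mulmxDr -scalemxAr mulmxDl -scalemxAl mxE [X in _ + X]mxE.
Qed.

Lemma spdD W C (g : R) : spd W -> spsd C -> 0 <= g -> spd (W + g *: C).
Proof.
move=> [Ws W0] [Cs C0] g0; split; first by rewrite linearD/= linearZ/= Ws Cs.
by move=> x x0; rewrite qformD_mx; apply: ltr_pwDl; [exact: W0|rewrite mulr_ge0//; exact: C0].
Qed.

(* Cauchy-Schwarz for [bform W]: the i-th entry of x is the W-product of x with
   W^-1 e_i, whose W-square is (W^-1) i i. *)
Lemma coord_sq_le W x i : spd W -> x i 0 ^+ 2 <= invmx W i i * qform W x.
Proof.
move=> Wspd; have Wu := spd_unitmx _ Wspd; case: (Wspd) => Ws W0.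
pose y : 'cV[R]_M := invmx W *m delta_mx i 0.
have Wy : W *m y = delta_mx i 0 by rewrite mulKVmx.
have yi : y i 0 = invmx W i i by rewrite /y -colE mxE.
have bxy z : bform W z y = z i 0.
  by rewrite /bform -mulmxA Wy -colE !mxE.
have qy : qform W y = invmx W i i by rewrite -yi -bxy.
have qy0 : 0 < invmx W i i.
  rewrite -qy; apply: W0; apply/eqP => y0.
  have := congr1 (fun v : 'cV[R]_M => v i 0) Wy.
  by rewrite y0 mulmx0 !mxE !eqxx mulr1n => /eqP; rewrite eq_sym oner_eq0.
(* The scalar minimizes the W-square of [x + s *: y] over [s]; nonnegativity of the minimum, times
   [invmx W i i], is the claim. *)
have := spd_ge0 W (x + (- (x i 0 / invmx W i i)) *: y) Wspd.
rewrite qformDZ// bformC// bxy qy => h.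
rewrite -subr_ge0 (_ : _ - _ = invmx W i i *
  (qform W x + 2 * - (x i 0 / invmx W i i) * x i 0
   + (- (x i 0 / invmx W i i)) ^+ 2 * invmx W i i)); first by rewrite mulr_ge0// ltW.
by field; rewrite gt_eqF.
Qed.

Lemma qform_sum S x : qform S x = \sum_i \sum_j S i j * x i 0 * x j 0.
Proof.
rewrite /qform -mulmxA mxE; apply: eq_bigr => i _.
by rewrite !mxE mulr_sumr; apply: eq_bigr => j _; rewrite mulrCA mulrA.
Qed.

(** Each square of an entry of x is at most [D * qform W x] by [coord_sq_le], hence so is each
    product of two entries; weighting by the entries of S gives an explicit K without
    compactness. *)
Lemma qform_dominated S W : spd W ->
  exists2 K : R, 0 < K & forall x, qform S x <= K * qform W x.
Proof.
move=> Wspd; pose D := \sum_i `|invmx W i i|.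
have D0 : 0 <= D by apply: sumr_ge0.
have xD x i : x i 0 ^+ 2 <= D * qform W x.
  apply: (le_trans (coord_sq_le W x i Wspd)).
  rewrite ler_wpM2r ?spd_ge0//; apply: (le_trans (ler_norm _)).
  by rewrite /D (bigD1 i)//= lerDl sumr_ge0.
pose s := \sum_i \sum_j `|S i j|.
have s0 : 0 <= s by do 2 (apply: sumr_ge0 => ? _).
(* The summand 1 keeps K positive even when S is zero. *)
exists (s * D + 1) => [|x]; first by rewrite ltr_pwDr// mulr_ge0.
have q0 := spd_ge0 W x Wspd.
suff : qform S x <= s * (D * qform W x) by nra.
rewrite qform_sum /s mulr_suml ler_sum// => i _.
rewrite mulr_suml ler_sum// => j _; rewrite -mulrA.
apply: (le_trans (ler_norm _)); rewrite normrM ler_wpM2l//.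
have := xD x i; have := xD x j.
by rewrite ler_norml; nra.
Qed.

Lemma energy_decay A W (K : R) : spd A -> spd W ->
  (forall x, qform A x <= K * qform W x) ->
  exists2 c : R, 0 < c & forall (h : R) v, 0 < h -> h * K <= 1 ->
    qform A (v - h *: (invmx W *m (A *m v))) <= (1 - h * c) * qform A v.
Proof.
move=> Aspd Wspd AK; have Wu := spd_unitmx _ Wspd; have Au := spd_unitmx _ Aspd.
have [As _] := Aspd; have [Ws _] := Wspd.
(* With p = W^-1 A v, the energy v^T A v equals p^T (W A^-1 W) p, so it is at most L p^T W p. This
   gives c = 1/L. *)
have [L L0 hL] := qform_dominated (W *m invmx A *m W) W Wspd.
exists L^-1 => [|h v h0 hK]; first by rewrite invr_gt0.
set p := invmx W *m (A *m v).
have Wp : W *m p = A *m v by rewrite mulKVmx.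
have bpv : bform A p v = qform W p by rewrite /bform /qform -!mulmxA Wp.
have qv : qform A v = qform (W *m invmx A *m W) p.
  have pW : p^T *m W = v^T *m A by rewrite -{1}Ws -trmx_mul Wp trmx_mul As.
  by rewrite /qform -!mulmxA Wp mulKmx// (mulmxA p^T) pW -mulmxA.
have q0 := spd_ge0 W p Wspd.
have := hL p; rewrite -qv => vp.
have qAp := AK p.
rewrite -scaleNr qformDZ// bpv.
have : L^-1 * qform A v <= qform W p by rewrite ler_pdivrMl.
(* Since h K <= 1, the quadratic term uses up at most half of the decrease 2 h p^T W p. *)
have h2 : h ^+ 2 * qform A p <= h * qform W p.
  rewrite expr2 -mulrA ler_pM2l//.
  apply: (le_trans (ler_wpM2l (ltW h0) qAp)); rewrite mulrA.
  by apply: (le_trans (ler_wpM2r q0 hK)); rewrite mul1r.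
by move=> h3; have := ler_wpM2l (ltW h0) h3; lra.
Qed.
End quadratic_forms.

(** * Convergence of matrices and of sequences with a contraction estimate *)

Lemma cvg_mx_entries {R : realType} {m n : nat} (Y : nat -> 'M[R]_(m, n)) (L : 'M[R]_(m, n)) :
  (forall i j, Y k i j @[k --> \oo] --> L i j) -> Y k @[k --> \oo] --> L.
Proof.
move=> YL; apply/cvgrPdist_lt => e e0.
have : forall ij : 'I_m * 'I_n, \forall k \near \oo, `|L ij.1 ij.2 - Y k ij.1 ij.2| < e.
  by by move=> [i j]; have /cvgrPdist_lt := YL i j; exact.
move/filter_forall; apply: filterS => k h.
rewrite [ltLHS]mx_normrE; apply: bigmax_lt => // ij _.
by rewrite !mxE; exact: h.
Qed.

(** The product of the factors 1 + c h_j is at least 1 + c S_k, with S_k the partial sum of h, and 1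
    - c h_j <= 1/(1 + c h_j). Thus V_k <= V_0/(1 + c S_k), which tends to 0. *)
Lemma decay_cvg0 {R : realType} (V h : nat -> R) (c : R) : 0 < c ->
  (forall k, 0 <= V k) -> (forall k, 0 < h k.+1) ->
  (forall k, V k.+1 <= (1 - h k.+1 * c) * V k) ->
  (\sum_(1 <= k <oo) (h k)%:E = +oo)%E ->
  V k @[k --> \oo] --> 0.
Proof.
move=> c0 V0 h0 VS hoo.
pose S k := \sum_(1 <= j < k.+1) h j.
have S0 k : 0 <= S k.
  by rewrite /S big_add1 sumr_ge0// => j _; exact/ltW/h0.
have VSk k : V k * (1 + c * S k) <= V 0%N.
  elim: k => [|k IH]; first by rewrite /S big_geq// mulr0 addr0 mulr1.
  apply: le_trans IH.
  have -> : S k.+1 = S k + h k.+1 by rewrite /S big_nat_recr.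
  have h1 := VS k; have := h0 k; have := S0 k; have := V0 k; have := V0 k.+1.
  move: (V k) (V k.+1) (S k) (h k.+1) h1 => a b s z hb b0 a0 s0 z0.
  have cz : 0 < c * z by rewrite mulr_gt0.
  (* This uses (1 - c z)(1 + c z) <= 1, valid also for c z > 1. *)
  have : b * (1 + c * z) <= a.
    apply: (@le_trans _ _ ((1 - z * c) * a * (1 + c * z))).
      by rewrite ler_wpM2r//; lra.
    have : 0 <= a * (c * z) ^+ 2 by apply: mulr_ge0 => //; exact: sqr_ge0.
    by lra.
  have : b * (1 + c * (s + z)) <= b * (1 + c * z) * (1 + c * s).
    have : 0 <= b * (c * z) * (c * s) by rewrite !mulr_ge0// ltW.
    lra.
  move=> h1 h2; apply: (le_trans h1); rewrite ler_wpM2r//.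
  have : 0 <= c * s by rewrite mulr_ge0// ltW.
  lra.
have Soo : S k @[k --> \oo] --> +oo.
  apply/cvgryPge => L.
  have Sk k : (\sum_(1 <= j < k.+1) (h j)%:E)%E = (S k)%:E by rewrite sumEFin.
  have cvS : (\sum_(1 <= j < k) (h j)%:E)%E @[k --> \oo] --> +oo%E.
    rewrite -hoo; apply: is_cvg_nneseries => -[//|k] _ _.
    by rewrite lee_fin ltW.
  (* The partial sums of the series exclude their upper index while [S k] includes k, hence the
     shift by one. *)
  move: cvS; rewrite -cvg_shiftS => /cvgeyPge/(_ L).
  by apply: filterS => k /=; rewrite Sk lee_fin.
have Voo : (V 0%N / (1 + c * S k)) @[k --> \oo] --> 0.
  rewrite -(mulr0 (V 0%N)); apply: cvgM; first exact: cvg_cst.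
  apply/gtr0_cvgV0.
    by apply: nearW => k; rewrite ltr_wpDr// mulr_ge0// ltW.
  apply/cvgryPge => L; move/cvgryPge/(_ (L / c)) : Soo.
  apply: filterS => k; rewrite ler_pdivrMr// mulrC => h1.
  by rewrite (le_trans h1)// lerDr.
apply: (squeeze_cvgr _ (cvg_cst 0) Voo).
apply: nearW => k; rewrite V0/= ler_pdivlMr//.
by rewrite ltr_wpDr// mulr_ge0// ltW.
Qed.

(** * Linearity of real-valued integrals *)

Section real_integrals.
Context {d : measure_display} {T : measurableType d} {R : realType}.
Variables (mu : {measure set T -> \bar R}) (D : set T).
Hypothesis mD : measurable D.
Implicit Types g h : T -> R.

Lemma integrable_addR g h :
  mu.-integrable D (EFin \o g) -> mu.-integrable D (EFin \o h) ->
  mu.-integrable D (EFin \o (fun x => g x + h x)).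
Proof. by move=> ig ih; exact: (integrableD mD ig ih). Qed.

Lemma integrable_mulRl (r : R) g : mu.-integrable D (EFin \o g) ->
  mu.-integrable D (EFin \o (fun x => r * g x)).
Proof. by move=> ig; exact: (integrableZl mD r ig). Qed.

(** One induction proves both claims, since splitting off the head of the integral requires
    integrability of the tail. *)
Lemma integrable_sumR (I : Type) (s : seq I) (g : I -> T -> R) :
  (forall i, mu.-integrable D (EFin \o g i)) ->
  mu.-integrable D (EFin \o (fun x => \sum_(i <- s) g i x)) /\
  \int[mu]_(x in D) (\sum_(i <- s) g i x) = \sum_(i <- s) \int[mu]_(x in D) g i x.
Proof.
move=> ig; elim: s => [|i s [ints es]].
  have -> : (fun x : T => \sum_(i <- [::]) g i x) = cst 0.
    by apply/funext => x; rewrite big_nil.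
  by rewrite big_nil; split; [exact: integrable0|rewrite /Rintegral integral0].
have -> : (fun x => \sum_(j <- i :: s) g j x) = fun x => g i x + \sum_(j <- s) g j x.
  by apply/funext => x; rewrite big_cons.
by split; [exact: integrable_addR|rewrite RintegralD// big_cons es].
Qed.
End real_integrals.

(** * First-order optimality and the normal equations *)

Lemma quadratic_ge0_slope0 {R : realFieldType} (g a : R) :
  (forall s, 0 <= s * (2 * g) + s ^+ 2 * a) -> g = 0.
Proof.
(* The vertex -g/a may not exist. At s = -g/b, with b positive and above a, the value is a negative
   multiple of g^2. *)
move=> h; set b := `|a| + 1.
have ab : a < b by rewrite ltr_pwDr// ler_norm.
have b0 : 0 < b by rewrite ltr_pwDr.
have := h (- g / b).
have -> : - g / b * (2 * g) + (- g / b) ^+ 2 * a = (a - 2 * b) / b ^+ 2 * g ^+ 2.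
  by field; rewrite gt_eqF.
rewrite nmulr_rge0; last by rewrite pmulr_llt0 ?invr_gt0 ?exprn_gt0//; lra.
by move=> g0; apply/eqP; rewrite -sqrf_eq0 eq_le g0 sqr_ge0.
Qed.

(** Moving [uhat] by s along the i-th basis vector changes the error by 2 s g + s^2 a, where g is
    the i-th entry of A uhat - b; minimality forces g = 0. *)
Lemma normal_equations {R : realType} {M : nat} (I : interval R)
    (rho f : R -> R) (phi : 'I_M -> R -> R) (uhat : 'cV[R]_M) :
  measurable_fun [set` I] rho -> (forall x, x \in I -> 0 <= rho x) ->
  (forall i, measurable_fun [set` I] (phi i)) ->
  measurable_fun [set` I] f ->
  (forall i j, Erho_finite I rho (fun x => phi i x * phi j x)) ->
  (forall i, Erho_finite I rho (fun x => phi i x * f x)) ->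
  argmin_mse I rho phi f = [set uhat] ->
  gram I rho phi *m uhat = load I rho phi f.
Proof.
move=> mrho rho0 mphi mf iphi if_ am.
have mI : measurable [set` I] by exact: measurable_itv.
pose r (v : 'cV[R]_M) x := \sum_j v j 0 * phi j x - f x.
have mse_ge0 v : (0 <= mean_sq_error I rho phi f v)%E.
  by apply: integral_ge0 => x Ix; rewrite lee_fin mulr_ge0 ?sqr_ge0 ?rho0.
have minu : forall v, (mean_sq_error I rho phi f uhat <= mean_sq_error I rho phi f v)%E.
  by have : [set uhat] uhat by []; rewrite -am.
have [uoo|ufin] := eqVneq (mean_sq_error I rho phi f uhat) +oo%E.
  (* Every vector is then a minimizer, so uniqueness makes the space trivial. *)
  have all_eq (v : 'cV[R]_M) : v = uhat.
    suff : argmin_mse I rho phi f v by rewrite am.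
    move=> w; apply: (le_trans (leey _)); rewrite -uoo; exact: minu.
  by rewrite (all_eq (load _ _ _ _)).
have mr v : measurable_fun [set` I] (fun x => r v x ^+ 2 * rho x).
  apply: measurable_funM => //; apply: measurable_funX; apply: measurable_funB => //.
  apply: measurable_sum => j; apply: measurable_funM => //; exact: measurable_cst.
(* In the remaining case the minimal error is finite, which is integrability of the squared
   residual. *)
have ir2 : lebesgue_measure.-integrable [set` I]
    (EFin \o (fun x => r uhat x ^+ 2 * rho x)).
  apply/integrableP; split; first by apply/measurable_EFinP; exact: mr.
  move: ufin; rewrite -ltey; apply: le_lt_trans; rewrite le_eqVlt; apply/orP; left.
  apply/eqP/eq_integral => x /set_mem Ix.
  by rewrite /= ger0_norm//; apply: mulr_ge0; [exact: sqr_ge0|exact: rho0].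
apply/matrixP => i k; rewrite (ord1 k) {k}.
apply/eqP; rewrite -subr_eq0; apply/eqP.
set g := _ - _.
(* This is residual times [phi i] times [rho], written as a combination of products assumed
   integrable; its integral is g. *)
pose rp x := \sum_j uhat j 0 * (phi i x * phi j x * rho x) + (- 1) * (phi i x * f x * rho x).
have [isum esum] := @integrable_sumR _ (measurableTypeR R) R lebesgue_measure
  [set` I] mI _ (index_enum 'I_M)
  (fun j x => uhat j 0 * (phi i x * phi j x * rho x))
  (fun j => @integrable_mulRl _ (measurableTypeR R) R lebesgue_measure _ mI _ _ (iphi i j)).
have irp : lebesgue_measure.-integrable [set` I] (EFin \o rp).
  by apply: integrable_addR => //; apply: integrable_mulRl => //; exact: if_.
have erp : \int[lebesgue_measure]_(x in [set` I]) rp x = g.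
  rewrite RintegralD//; last by apply: integrable_mulRl => //; exact: if_.
  rewrite esum RintegralZl//; last exact: if_.
  rewrite /g !mxE mulN1r; congr (_ - _); apply: eq_bigr => j _.
  by rewrite RintegralZl//; [rewrite mxE mulrC|exact: iphi].
pose a := \int[lebesgue_measure]_(x in [set` I]) (phi i x * phi i x * rho x).
apply: (@quadratic_ge0_slope0 _ g a) => s.
have := minu (uhat + s *: delta_mx i 0).
have rE x : r (uhat + s *: delta_mx i 0) x = r uhat x + s * phi i x.
  rewrite /r; under eq_bigr do rewrite !mxE mulrDl.
  rewrite big_split/= [X in _ + X - _](bigD1 i)//= !eqxx mulr1 [X in _ + (_ + X) - _]big1.
    by rewrite addr0 addrAC.
  by move=> j /negPf ->; rewrite mulr0 mul0r.
have i2 : lebesgue_measure.-integrable [set` I] (EFin \o (fun x => (s * 2) * rp x)).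
  exact: integrable_mulRl.
have i3 : lebesgue_measure.-integrable [set` I]
   (EFin \o (fun x => s ^+ 2 * (phi i x * phi i x * rho x))).
  by apply: integrable_mulRl => //; exact: iphi.
have i23 := @integrable_addR _ (measurableTypeR R) R lebesgue_measure _ mI _ _ i2 i3.
have expand x : r (uhat + s *: delta_mx i 0) x ^+ 2 * rho x =
    r uhat x ^+ 2 * rho x + (s * 2 * rp x + s ^+ 2 * (phi i x * phi i x * rho x)).
  rewrite rE; have -> : rp x = r uhat x * phi i x * rho x.
    rewrite /rp /r mulrBl mulrBl !mulr_suml mulN1r; congr (_ - _); last by ring.
    by apply: eq_bigr => j _; ring.
  by ring.
rewrite /mean_sq_error /Erho -/(r _ _); under [leRHS]eq_integral do rewrite -/(r _ _) expand.
(* Both errors are finite, so the comparison passes to reals and the error of [uhat] cancels. *)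
move/fine_le; rewrite !integrable_fin_num//; last first.
  exact: (@integrable_addR _ (measurableTypeR R) R lebesgue_measure _ mI _ _ ir2 i23).
move=> /(_ isT isT); rewrite -!/(Rintegral _ _ _).
rewrite (RintegralD _ ir2 i23)// (RintegralD _ i2 i3)// RintegralZl// erp.
by rewrite RintegralZl//; [rewrite -/a -/(r _ _); lra|exact: iphi].
Qed.

(** * Expectation of a product of independent variables *)

Section independence.
Context {d : measure_display} {T : measurableType d} {R : realType}.
Variable P : probability T R.

(** The joint law is the product of the two laws, so Fubini applies to the function z1 z2 on the
    plane. *)
Lemma independent_expectation_mul (Z1 Z2 : T -> R) :
  P.-integrable [set: T] (EFin \o Z1) -> P.-integrable [set: T] (EFin \o Z2) ->
  independent P Z1 Z2 ->
  P.-integrable [set: T] (EFin \o (fun w => Z1 w * Z2 w)) /\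
  \int[P]_w (Z1 w * Z2 w) = (\int[P]_w Z1 w) * (\int[P]_w Z2 w).
Proof.
move=> i1 i2 ind.
have m1 : measurable_fun [set: T] Z1 by apply/measurable_EFinP; exact: measurable_int i1.
have m2 : measurable_fun [set: T] Z2 by apply/measurable_EFinP; exact: measurable_int i2.
pose X1 : {RV P >-> R} := HB.pack Z1 (isMeasurableFun.Build _ _ _ _ Z1 m1).
pose X2 : {RV P >-> R} := HB.pack Z2 (isMeasurableFun.Build _ _ _ _ Z2 m2).
have m12 : measurable_fun [set: T] (fun w => (Z1 w, Z2 w)).
  exact/measurable_fun_pair.
pose X12 : {mfun T >-> (R * R)%type} :=
  HB.pack (fun w => (Z1 w, Z2 w)) (isMeasurableFun.Build _ _ _ _ (fun w => (Z1 w, Z2 w)) m12).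
pose D1 := distribution P X1; pose D2 := distribution P X2.
pose D := distribution P X12.
(* Independence is agreement on rectangles, which determines the product measure. *)
have DE A : measurable A -> (D1 \x D2)%E A = D A.
  apply: product_measure_unique => S1 S2 mS1 mS2.
  by rewrite /D /distribution/= /pushforward -ind//.
pose F (z : R * R) := (z.1 * z.2)%:E.
have mF : measurable_fun setT F.
  apply/measurable_EFinP; apply: measurable_funM; [exact: measurable_fst|exact: measurable_snd].
have iD1 : D1.-integrable [set: R] EFin by apply: integrable_pushforward.
have iD2 : D2.-integrable [set: R] EFin by apply: integrable_pushforward.
have FE x y : F (x, y) = (x%:E * y%:E)%E by rewrite /F EFinM.
have [/integrableP[_ f1] /integrableP[_ f2]] := (iD1, iD2).
(* By Tonelli the integral of |x y| factors into the two finite absolute first moments. *)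
have iF : (D1 \x D2)%E.-integrable [set: R * R] F.
  apply/integrable12ltyP => //.
  under eq_integral => x _.
    under eq_integral do rewrite FE abseM.
    rewrite ge0_integralZl//; last by apply: measurableT_comp => //.
    over.
  rewrite ge0_integralZr//; last 2 first.
    by apply: measurableT_comp => //.
    by apply: integral_ge0.
  by rewrite lte_mul_pinfty ?integral_ge0// ge0_fin_numE ?integral_ge0.
have iFD : P.-integrable [set: T] (F \o X12).
  have [_ foo] := integrableP _ _ _ iF.
  apply/integrableP; split; first exact: measurableT_comp.
  move: foo; rewrite (eq_measure_integral D) => [|A mA _]; last exact: DE.
  by rewrite ge0_integral_pushforward//; exact: measurableT_comp.
split; first exact: iFD.
have eD1 : \int[D1]_x x = \int[P]_w Z1 w.
  by rewrite /Rintegral integral_pushforward.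
have eD2 : \int[D2]_x x = \int[P]_w Z2 w.
  by rewrite /Rintegral integral_pushforward.
rewrite -eD1 -eD2 -RintegralZr// -[LHS]/(fine (\int[P]_w (F \o X12) w)%E).
rewrite -[X in fine X](@integral_pushforward _ _ _ _ _ X12 _ P setT F)//.
rewrite (eq_measure_integral (D1 \x D2)%E) => [|A mA _]; last exact/esym/DE.
rewrite -integral12_prod_meas1//; congr fine; apply: eq_integral => x _.
rewrite /fubini_F /=; under eq_integral do rewrite FE.
rewrite integralZl//= EFinM. rewrite fineK//; exact: (integrable_fin_num measurableT iD2).
Qed.
End independence.

(** * Means of random matrices and of one iteration step *)

Section random_matrix_means.
Context {d : measure_display} {T : measurableType d} {R : realType}.
Variable P : probability T R.

Lemma EmxE {m n : nat} (Y : T -> 'M[R]_(m, n)) i j :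
  Emx P Y i j = \int[P]_w Y w i j.
Proof. by rewrite mxE unlock. Qed.

Lemma has_mean_cst {m n : nat} (c : 'M[R]_(m, n)) : has_mean P (fun=> c) c.
Proof.
have ic : integrable_mx P (fun=> c).
  by move=> i j; exact: finite_measure_integrable_cst.
split=> //; apply/matrixP => i j; rewrite EmxE Rintegral_cst//.
rewrite [X in fine X](_ : _ = 1%E) ?mulr1//; exact: probability_setT.
Qed.

Lemma has_meanD {m n : nat} (Y Z : T -> 'M[R]_(m, n)) y z :
  has_mean P Y y -> has_mean P Z z -> has_mean P (fun w => Y w + Z w) (y + z).
Proof.
move=> [iY <-] [iZ <-].
have E i j : (fun w => (Y w + Z w) i j) = (fun w => Y w i j + Z w i j).
  by apply/funext => w; rewrite mxE.
split=> [i j|].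
  have := integrable_addR P setT measurableT _ _ (iY i j) (iZ i j).
  by rewrite -E.
apply/matrixP => i j; rewrite [RHS]mxE !EmxE E RintegralD//; [exact: iY|exact: iZ].
Qed.

Lemma has_mean_mulmxl {m n p : nat} (L : 'M[R]_(m, n)) (Y : T -> 'M[R]_(n, p)) y :
  has_mean P Y y -> has_mean P (fun w => L *m Y w) (L *m y).
Proof.
move=> [iY <-].
have iLY i j k : P.-integrable [set: T] (EFin \o (fun w => L i k * Y w k j)).
  by apply: integrable_mulRl => //; exact: iY.
have E i j : (fun w => (L *m Y w) i j) = (fun w => \sum_k L i k * Y w k j).
  by apply/funext => w; rewrite mxE.
have S i j := integrable_sumR P setT measurableT _ (index_enum 'I_n) _ (iLY i j).
split=> [i j|]; first by have [h _] := S i j; move: h; rewrite -E.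
apply/matrixP => i j; rewrite [RHS]mxE EmxE E; have [_ ->] := S i j.
by apply: eq_bigr => k _; rewrite RintegralZl ?EmxE//; exact: iY.
Qed.

(** Every entry is a finite sum of products of independent entries. Z stands first in the
    independence hypothesis because the iterate, the right factor, does so in assumption 4. *)
Lemma has_mean_mulmx {m n p : nat} (Y : T -> 'M[R]_(m, n)) (Z : T -> 'M[R]_(n, p)) y z :
  has_mean P Y y -> has_mean P Z z ->
  (forall i j k, independent P (fun w => Z w k j) (fun w => Y w i k)) ->
  has_mean P (fun w => Y w *m Z w) (y *m z).
Proof.
move=> [iY <-] [iZ <-] ind.
have iYZ i j k := independent_expectation_mul P _ _ (iZ k j) (iY i k) (ind i j k).
have E i j : (fun w => (Y w *m Z w) i j) = (fun w => \sum_k Z w k j * Y w i k).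
  by apply/funext => w; rewrite mxE; apply: eq_bigr => k _; rewrite mulrC.
have S i j := integrable_sumR P setT measurableT _ (index_enum 'I_n) _ (fun k => (iYZ i j k).1).
split=> [i j|]; first by have [h _] := S i j; move: h; rewrite -E.
apply/matrixP => i j; rewrite [RHS]mxE EmxE E; have [_ ->] := S i j.
by apply: eq_bigr => k _; rewrite (iYZ i j k).2 !EmxE mulrC.
Qed.

Lemma integrable_second_moment {n : nat} (v : T -> 'cV[R]_n) :
  random_mx v -> integrable_mx P (fun w => v w *m (v w)^T) -> integrable_mx P v.
Proof.
move=> mv iv i j; rewrite (ord1 j).
have isq : P.-integrable [set: T] (EFin \o (fun w => 1 + v w i 0 ^+ 2)).
  apply: integrable_addR => //; first exact: finite_measure_integrable_cst.
  have := iv i i; congr (integrable P _ _); apply/funext => w /=.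
  by rewrite mxE big_ord1 mxE expr2.
apply: (le_integrable _ _ _ isq) => //.
  by apply/measurable_EFinP; exact: mv.
move=> w _ /=; rewrite lee_fin [leRHS]ger0_norm ?addr_ge0 ?sqr_ge0//.
(* Expanding (|v_i| - 1)^2 >= 0 gives |v_i| <= 1 + v_i^2, and v_i^2 is a diagonal entry of v v^T. *)
have := sqr_ge0 (`|v w i 0| - 1); rewrite -(real_normK (num_real (v w i 0))).
by have := normr_ge0 (v w i 0); nra.
Qed.

(** The residual is theta - Omega v - A (v - uhat). The first term has mean 0, and so has the second
    by independence, which leaves the deterministic recursion. *)
Lemma has_mean_step {n : nat} (v theta : T -> 'cV[R]_n) (Omega : T -> 'M[R]_n)
    (A Psi : 'M[R]_n) (uhat m : 'cV[R]_n) (h : R) :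
  has_mean P theta 0 -> has_mean P Omega 0 ->
  has_mean P (fun w => v w - uhat) m ->
  (forall i j, independent P (fun w => v w j 0) (fun w => Omega w i j)) ->
  has_mean P
    (fun w => v w + h *: (Psi *m (theta w + A *m uhat - (Omega w + A) *m v w)) - uhat)
    (m - h *: (Psi *m (A *m m))).
Proof.
move=> mtheta mOmega me ind.
have mv : has_mean P v (m + uhat).
  have := has_meanD _ _ _ _ me (has_mean_cst uhat).
  by under eq_fun do rewrite subrK.
have mOv : has_mean P (fun w => Omega w *m v w) 0.
  rewrite -(mul0mx _ (m + uhat)); apply: has_mean_mulmx => // i j k.
  by rewrite (ord1 j).
have := has_meanD _ _ _ _ me (has_meanD _ _ _ _ (has_mean_mulmxl (h *: Psi) _ _ mtheta)
  (has_meanD _ _ _ _ (has_mean_mulmxl (- (h *: Psi)) _ _ mOv)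
   (has_mean_mulmxl (- (h *: Psi *m A)) _ _ me))).
rewrite !mulmx0 !add0r mulNmx -!scalemxAl -mulmxA.
congr (has_mean P _ _); apply/funext => w.
have -> : theta w + A *m uhat - (Omega w + A) *m v w =
    theta w - Omega w *m v w - A *m (v w - uhat).
  by rewrite mulmxDl mulmxBr opprB opprD addrACA [A *m uhat - _]addrC addrA.
rewrite [in RHS]addrAC; congr (_ + _).
by rewrite !mulmxBr !scalerBr !mulNmx -!scalemxAl -!mulmxA -opprD addrA.
Qed.
End random_matrix_means.

(** * Convergence of the mean error *)

Theorem theorem1 (R : realType) (M : nat) (A B C : 'M[R]_M)
  (hA : spd A) (hB : spd B) (hC : spsd C)
  (hBA : forall x : 'cV[R]_M, euclidean_norm x = 1 ->
    0 < qform (invmx B *m A) x) :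
  exists gamma0 mu0 : R, [/\ 0 < gamma0, 0 < mu0 &
    forall (d : measure_display) (T : measurableType d) (P : probability T R)
      (Tm I : interval R) (X : R -> {RV P >-> R}) (rho f : R -> R)
      (phi : 'I_M -> R -> R) (uhat : 'cV[R]_M)
      (N : nat) (t : nat -> nat -> R) (u0 : T -> 'cV[R]_M),
    let b := load I rho phi f in
    let theta k w := sample_load X phi f N t k w - b in
    let Omega k w := sample_gram X phi N t k w - A in
    let u := iterate X phi f N t B C u0 in
    (* the process *)
    strictly_stationary Tm X ->
    (forall s, s \in Tm -> forall w, X s w \in I) ->
    measurable_fun [set` I] rho -> (forall x, x \in I -> 0 <= rho x) ->
    (forall s, s \in Tm -> has_density I rho (X s)) ->
    (* the best approximation problem *)
    (forall i, measurable_fun [set` I] (phi i)) ->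
    measurable_fun [set` I] f ->
    lin_indep I phi ->
    (forall i j, Erho_finite I rho (fun x => phi i x * phi j x)) ->
    (forall i, Erho_finite I rho (fun x => phi i x * f x)) ->
    A = gram I rho phi ->
    argmin_mse I rho phi f = [set uhat] ->
    (* the samples *)
    (0 < N)%N -> sampling_times N t Tm ->
    (* the initial vector *)
    random_mx u0 -> integrable_mx P (fun w => u0 w *m (u0 w)^T) ->
    (* assumption 1 *)
    iid P (fun k => theta k.+1) ->
    (forall k, (1 <= k)%N -> has_mean P (theta k) 0) ->
    (* assumption 2 *)
    (forall k w, (1 <= k)%N -> (Omega k w)^T = Omega k w) ->
    iid P (fun k => Omega k.+1) ->
    (forall k, (1 <= k)%N -> has_mean P (Omega k) 0) ->
    (* assumption 3 *)
    stationary_moment P theta theta ->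
    stationary_moment P (fun k w => vec (Omega k w))
      (fun k w => vec (Omega k w)) ->
    stationary_moment P (fun k w => vec (Omega k w)) theta ->
    (* assumption 4 *)
    (forall (gamma : R) (mu : nat -> R), 0 <= gamma ->
      (forall k, (1 <= k)%N -> 0 < mu k) ->
      forall k, (1 <= k)%N -> forall Z1 Z2 : T -> R,
        with_products (entries (u gamma mu k.-1)) Z1 ->
        with_products (entries (theta k) `|` entries (Omega k)) Z2 ->
        independent P Z1 Z2) ->
    (* conclusion *)
    forall mu : nat -> R,
      (forall k, (1 <= k)%N -> 0 < mu k <= mu0) ->
      (\sum_(1 <= k <oo) (mu k)%:E = +oo)%E ->
      forall gamma : R, 0 <= gamma <= gamma0 ->
        let e k w := u gamma mu k w - uhat in
        (forall k, integrable_mx P (e k)) /\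
        (Emx P (e k) @[k --> \oo] --> (0 : 'cV[R]_M))].
Proof.
have [K K0 AK] := qform_dominated A B hB.
(* K compares A with B alone, so 1/K bounds the steps for every gamma >= 0 and the value 1 for
   gamma_0 is an arbitrary positive choice. *)
exists 1, K^-1; split; [by []|by rewrite invr_gt0|].
move=> d T P Tm I X rho f phi uhat N t u0 b theta Omega u _ _ mrho rho0 _ mphi mf _
  iphi if_ Agram am _ _ mu0 iu0 _ mtheta _ _ mOmega _ _ _ ind mu mu_bd mu_oo
  gamma /andP[gamma0 _] e.
have Auhat : A *m uhat = b.
  by rewrite Agram; apply: normal_equations.
pose W := B + gamma *: C.
have Wspd : spd W := spdD _ _ _ hB hC gamma0.
have mu_gt0 k : (1 <= k)%N -> 0 < mu k by move=> /mu_bd/andP[].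
have AW x : qform A x <= K * qform W x.
  apply: (le_trans (AK x)); rewrite ler_pM2l// /W qformD_mx lerDl.
  by rewrite mulr_ge0//; case: hC => _; apply.
have [c c0 decay] := energy_decay A W K hA Wspd AW.
pose m k := Emx P (e k).
have stepE k w : e k.+1 w = u gamma mu k w + mu k.+1 *: (invmx W *m
    (theta k.+1 w + A *m uhat - (Omega k.+1 w + A) *m u gamma mu k w)) - uhat.
  by rewrite Auhat /theta /Omega !subrK.
have e0 : has_mean P (e 0%N) (m 0%N).
  have iu : has_mean P u0 (Emx P u0) by split=> //; exact: integrable_second_moment.
  have [h1 _] := has_meanD _ _ _ _ _ iu (has_mean_cst P (- uhat)).
  by split.
have step k : has_mean P (e k) (m k) ->
    has_mean P (e k.+1) (m k - mu k.+1 *: (invmx W *m (A *m m k))).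
  move=> mek; have := has_mean_step P (u gamma mu k) (theta k.+1) (Omega k.+1)
     A (invmx W) uhat (m k) (mu k.+1) (mtheta k.+1 isT) (mOmega k.+1 isT) mek.
  rewrite (_ : (fun w => _) = e k.+1); last by apply/funext => w; rewrite stepE.
  (* Assumption 4 is used on single entries: of the iterate k and of [Omega k.+1]. *)
  apply=> i j; apply: (ind gamma mu gamma0 mu_gt0 k.+1 isT).
    by left; exists j, 0.
  by left; right; exists i, j.
(* As [m k] is [Emx] of [e k] by definition, the induction only has to carry integrability. *)
have mean k : has_mean P (e k) (m k).
  by elim: k => // k /step[ie _]; split.
split; first by move=> k; have [] := mean k.
have mS k : m k.+1 = m k - mu k.+1 *: (invmx W *m (A *m m k)).
  by have [_] := step k (mean k).
have Vcvg : qform A (m k) @[k --> \oo] --> 0.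
  apply: (decay_cvg0 (fun k => qform A (m k)) mu c c0) => //.
  - by move=> k; exact: spd_ge0.
  - by move=> k; exact: mu_gt0.
  - move=> k; rewrite mS; apply: decay; first exact: mu_gt0.
    have /andP[_ h] := mu_bd k.+1 isT.
    by apply: (le_trans (ler_wpM2r (ltW K0) h)); rewrite mulVf// gt_eqF.
apply: cvg_mx_entries => i j; rewrite (ord1 j) mxE.
apply/cvgr0Pnorm_lt => eps eps0.
(* By [coord_sq_le] for A this quantity bounds the square of the i-th entry, so it is compared with
   eps^2. *)
have : invmx A i i * qform A (m k) @[k --> \oo] --> 0.
  by rewrite -(mulr0 (invmx A i i)); apply: cvgM => //; exact: cvg_cst.
move/cvgr0Pnorm_lt/(_ _ (exprn_gt0 2 eps0)); apply: filterS => k h.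
rewrite -(@ltr_pXn2r _ 2)// ?nnegrE ?ltW//; apply: le_lt_trans h.
rewrite real_normK ?num_real//; apply: le_trans (ler_norm _).
exact: coord_sq_le.
Qed.
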